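(* Let $m\ge 3$, $n\ge 3$, let $x,y$ be two distinct vertices of the cycle $C_m$ with $p=d(x,y)$ (graph distance in $C_m$), and let $F_n(C_m)$ be the generalized sunflower graph formed from $n$ copies of $C_m$ with marked vertices $x,y$. Kemeny's constant of $F_n(C_m)$ is $$\mathscr K(F_n(C_m))=\frac{(n^2-6n+4)(pm-p^2)+m^2(2n-1)-2n-1}{6}.$$
   Context: For a connected graph $H$ with vertex set $\{1,\dots,N\}$ and Laplacian matrix $L$, the resistance distance between vertices $i,j$ is $r_H(i,j)=(e_i-e_j)^T L^\dagger (e_i-e_j)$, where $e_i$ is the $i$th standard unit vector and $L^\dagger$ is the Moore–Penrose pseudoinverse of $L$. Kemeny's constant of (the simple random walk on) a connected graph $H$ is given by $\mathscr K(H)=\frac{1}{4|E(H)|}\sum_{i,j\in V(H)} d_i d_j\, r_H(i,j)$, where $d_i$ is the degree of $i$ in $H$ and the sum is over ordered pairs; this formula may be taken as the definition. Generalized sunflower graph: fix distinct vertices $x,y$ of the cycle $C_m$. $F_n(C_m)$ is obtained from $n$ vertex-disjoint copies of $C_m$, labelled $1,\dots,n$, with $x_i,y_i$ the copies of $x,y$ in the $i$th copy, by identifying $y_i$ with $x_{i+1}$ for $1\le i<n$ and $y_n$ with $x_1$. *)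

(* Defs.v *)
From HB Require Import structures.
From mathcomp Require Import all_boot all_order all_algebra.

Set Implicit Arguments.
Unset Strict Implicit.
Unset Printing Implicit Defensive.

Import Order.TTheory GRing.Theory Num.Theory.

Local Open Scope ring_scope.

Section PseudoInverse.

Variable R : realFieldType.

(* The four Penrose equations (the transpose is the adjoint over a real
   field). *)
Definition penrose m n (A : 'M[R]_(m, n)) (X : 'M[R]_(n, m)) : Prop :=
  [/\ A *m X *m A = A, X *m A *m X = X,
      (A *m X)^T = A *m X & (X *m A)^T = X *m A].

(* A = B C is a full-rank factorization, with B = col_base A and
   C = row_base A; the pseudoinverse is C^T (C C^T)^-1 (B^T B)^-1 B^T. *)
Definition pinv m n (A : 'M[R]_(m, n)) : 'M[R]_(n, m) :=
  let B := col_base A in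
  let C := row_base A in
  C^T *m invmx (C *m C^T) *m invmx (B^T *m B) *m B^T.

Lemma gram_unitmx m n (C : 'M[R]_(m, n)) :
  row_free C -> C *m C^T \in unitmx.
Proof.
move=> Cfree; rewrite -row_free_unit; apply: inj_row_free => v vCC0.
apply/eqP; rewrite -(mulmx_free_eq0 v Cfree); apply/eqP.
have /matrixP/(_ 0 0) : (v *m C) *m (v *m C)^T = 0.
  by rewrite trmx_mul -!mulmxA (mulmxA C) mulmxA vCC0 mul0mx.
rewrite !mxE => /eqP; rewrite psumr_eq0 => [/allP sq0|i _]; last first.
  by rewrite !mxE -expr2 sqr_ge0.
apply/rowP => j; have := sq0 j (mem_index_enum j).
by rewrite !mxE mulf_eq0 orbb => /eqP.
Qed.

Lemma penrose_full_rank m n r (B : 'M[R]_(m, r)) (C : 'M[R]_(r, n)) :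
  row_full B -> row_free C ->
  penrose (B *m C) (C^T *m invmx (C *m C^T) *m invmx (B^T *m B) *m B^T).
Proof.
move=> fullB freeC; have uC := gram_unitmx freeC.
have uB : B^T *m B \in unitmx.
  rewrite -{2}[B]trmxK; apply: gram_unitmx.
  by rewrite /row_free mxrank_tr.
set X := _ *m B^T.
have AX : B *m C *m X = B *m invmx (B^T *m B) *m B^T.
  by rewrite !mulmxA -(mulmxA B C) (mulmxK uC).
have XA : X *m (B *m C) = C^T *m invmx (C *m C^T) *m C.
  by rewrite !mulmxA -(mulmxA _ B^T B) (mulmxKV uB).
split.
- by rewrite AX !mulmxA -(mulmxA _ B^T B) (mulmxKV uB).
- by rewrite XA !mulmxA -(mulmxA _ C C^T) (mulmxKV uC).
- by rewrite AX !trmx_mul trmxK trmx_inv trmx_mul trmxK mulmxA.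
- by rewrite XA !trmx_mul trmxK trmx_inv trmx_mul trmxK mulmxA.
Qed.

Lemma pinvP m n (A : 'M[R]_(m, n)) : penrose A (pinv A).
Proof.
have := penrose_full_rank (col_base_full A) (row_base_free A).
by rewrite mulmx_base.
Qed.

Lemma penrose_uniq m n (A : 'M[R]_(m, n)) (X Y : 'M[R]_(n, m)) :
  penrose A X -> penrose A Y -> X = Y.
Proof.
move=> [AXA XAX AXs XAs] [AYA YAY AYs YAs].
have eqAXAY : A *m X = A *m Y.
  by rewrite -AXs -{1}AYA -(mulmxA (A *m Y)) trmx_mul AXs AYs mulmxA AXA.
have eqXAYA : X *m A = Y *m A.
  rewrite -XAs -{1}AYA !mulmxA -(mulmxA _ Y A) trmx_mul XAs YAs.
  by rewrite -mulmxA (mulmxA A) AXA.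
by rewrite -XAX -mulmxA eqAXAY mulmxA eqXAYA YAY.
Qed.

End PseudoInverse.

Section Graph.

Variables (V : finType) (e : rel V).

Definition deg (v : V) : nat := #|[set w | e v w]|.

Definition edges : {set {set V}} :=
  [set A : {set V} | [exists u, exists v, e u v && (A == [set u; v])]].

Definition has_walk (u v : V) (k : nat) : bool :=
  [exists s : k.-tuple V, path e u s && (last u s == v)].

(* Equal to #|V| when v is not reachable from u. *)
Definition gdist (u v : V) : nat := find (has_walk u v) (iota 0 #|V|).

Lemma gdistP u v : connect e u v ->
  has_walk u v (gdist u v) /\ (forall k, has_walk u v k -> (gdist u v <= k)%N).
Proof.
move=> /connectP [s0 p0 ->]; case/shortenP: p0 => s ps us _.
set w := last u s.
have szs : (size s < #|V|)%N.
  by have := max_card (mem (u :: s)); rewrite (card_uniqP us).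
have ws : has_walk u w (size s).
  by apply/existsP; exists (in_tuple s); rewrite ps eqxx.
have hs : has (has_walk u w) (iota 0 #|V|).
  by apply/hasP; exists (size s) => //; rewrite mem_iota.
have lt : (gdist u w < #|V|)%N.
  by rewrite -[X in (_ < X)%N](size_iota 0) -has_find.
split=> [|k wk].
  by have := nth_find 0 hs; rewrite nth_iota.
rewrite leqNgt; apply/negP => ltk.
by have := before_find 0 ltk; rewrite nth_iota ?(ltn_trans ltk) // wk.
Qed.

(* Vertices are numbered by [enum_rank], so that matrices are indexed by
   ordinals. *)
Definition laplacian (R : realFieldType) : 'M[R]_#|V| :=
  \matrix_(i, j) ((deg (enum_val i))%:R *+ (i == j)
                  - (e (enum_val i) (enum_val j))%:R).

Definition resistance (R : realFieldType) (u v : V) : R :=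
  let d : 'cV[R]_#|V| :=
    delta_mx (enum_rank u) 0 - delta_mx (enum_rank v) 0 in
  (d^T *m pinv (laplacian R) *m d) 0 0.

Definition kemeny (R : realFieldType) : R :=
  (4 * #|edges|%:R)^-1 *
  \sum_(u : V) \sum_(v : V) (deg u)%:R * (deg v)%:R * resistance R u v.

End Graph.

(* Vertex identification in a graph (U, e): vertices related by the
   equivalence relation generated by g are merged. The new vertices are the
   equivalence classes, adjacent when they contain adjacent representatives. *)
Section Identification.

Variables (U : finType) (e g : rel U).

Definition identify_eqv : rel U := connect [rel a b | g a b || g b a].

Definition identify_vertex : finType :=
  {S : {set U} | S \in equivalence_partition identify_eqv [set: U]}.

Definition identify_adj : rel identify_vertex :=
  [rel S T : identify_vertex | [exists a in val S, exists b in val T, e a b]].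

End Identification.

Arguments identify_adj {U} e g.

Definition cycle_adj m : rel 'I_m :=
  [rel i j | (j == ordS i) || (i == ordS j)].

Arguments cycle_adj m : clear implicits.

(* n disjoint copies of C_m: the vertex (i, k) is vertex k of copy i. *)
Definition copies_adj n m : rel ('I_n * 'I_m) :=
  [rel a b | (a.1 == b.1) && cycle_adj m a.2 b.2].

Arguments copies_adj n m : clear implicits.

(* ordS is the cyclic successor, so this also glues the last copy to the
   first one. *)
Definition sunflower_glue n m (x y : 'I_m) : rel ('I_n * 'I_m) :=
  [rel a b | (a.2 == y) && (b == (ordS a.1, x))].

Arguments sunflower_glue n {m} x y.

Definition sunflower_adj n m (x y : 'I_m) :
  rel (identify_vertex (sunflower_glue n x y)) :=
  identify_adj (copies_adj n m) (sunflower_glue n x y).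

Arguments sunflower_adj n {m} x y.

Lemma ordS_neq n (i : 'I_n) : (1 < n)%N -> ordS i != i.
Proof.
move=> n_gt1; rewrite -val_eqE /=; have := ltn_ord i.
rewrite leq_eqVlt => /orP[/eqP eqn|lt]; last first.
  by rewrite modn_small // neq_ltn ltnSn orbT.
by rewrite eqn modnn eq_sym -lt0n -ltnS eqn.
Qed.

Definition sunflower_rep n m (x y : 'I_m) (a : 'I_n * 'I_m) : 'I_n * 'I_m :=
  if a.2 == y then (ordS a.1, x) else a.

Lemma sunflower_eqvE n m (x y : 'I_m) (a b : 'I_n * 'I_m) : x != y ->
  identify_eqv (sunflower_glue n x y) a b
  = (sunflower_rep x y a == sunflower_rep x y b).
Proof.
move=> nxy; set rep := sunflower_rep x y; rewrite /identify_eqv.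
set r : rel _ := (X in connect X).
have rsym : connect_sym r by apply: sym_connect_sym => c d; rewrite /r /= orbC.
have r_rep c d : sunflower_glue n x y c d -> rep c = rep d.
  by case/andP=> cy /eqP ->; rewrite /rep /sunflower_rep cy /= (negbTE nxy).
have c_rep c : connect r c (rep c).
  rewrite /rep /sunflower_rep; case: ifP => [cy|_]; last exact: connect0.
  by apply: connect1; rewrite /r /sunflower_glue /= cy eqxx.
apply/idP/eqP => [/connectP[s ps ->]|eq_rep].
  elim: s a ps => //= c s IHs a /andP[rac /IHs <-].
  by case/orP: rac => /r_rep.
apply: connect_trans (c_rep a) _; rewrite eq_rep rsym; exact: c_rep.
Qed.

Lemma sunflower_adj_sym n m (x y : 'I_m) :
  symmetric (sunflower_adj n x y).
Proof.
move=> S T; apply/existsP/existsP => -[a /andP[aS /existsP[b /andP[bT ab]]]];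
  exists b; rewrite bT; apply/existsP; exists a; rewrite aS /=;
  by move: ab; rewrite /copies_adj /cycle_adj /= eq_sym orbC.
Qed.

Lemma sunflower_adj_irr n m (x y : 'I_m) : (1 < n)%N -> x != y ->
  irreflexive (sunflower_adj n x y).
Proof.
move=> n_gt1 nxy S; apply/negbTE/negP.
case/existsP=> -[i k] /andP[aS /existsP[[j l] /andP[bS]]] /=.
case/andP=> /eqP/= eqij; rewrite -{}eqij in bS * => kl.
have m_gt1 : (1 < m)%N.
  by rewrite -[m]card_ord; apply/card_gt1P; exists x, y.
have nkl : k != l.
  case/orP: kl => /eqP ->; last exact: ordS_neq.
  by rewrite eq_sym ordS_neq.
have : identify_eqv (sunflower_glue n x y) (i, k) (i, l).
  case/imsetP: (valP S) aS bS => c _ -> .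
  by rewrite !inE !sunflower_eqvE //= => /eqP ca /eqP <-; rewrite -ca.
rewrite sunflower_eqvE // /sunflower_rep /=; have ni := ordS_neq i n_gt1.
case: (k =P y) => [ky|_]; case: (l =P y) => [ly|_]; rewrite xpair_eqE.
- by move: nkl; rewrite ky ly eqxx.
- by rewrite (negbTE ni).
- by rewrite eq_sym (negbTE ni).
- by rewrite (negbTE nkl) andbF.
Qed.

(* Main.v *)
(* If f is the voltage produced by a unit current entering at u and leaving at
   v, that is, if the Dirichlet form of f against every g is g u - g v, then the
   resistance between u and v is f u - f v. The edges of the sunflower lift
   uniquely to the n disjoint copies of C_m, so the Dirichlet form and the
   degree-weighted sums can both be computed on the copies. There the voltages
   are assembled from g(s, t) = min(s, t) - s t / m, the Green function of the
   m-cycle grounded at 0: each copy acts on the ring of copies as a resistor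
   rho = g(a, a), where a is the position of y counted from x. Kemeny's constant
   then reduces to power sums. *)

Require Import Defs.
From mathcomp Require Import all_boot all_order all_algebra.
From mathcomp Require Import zify ring.

Import GRing.Theory Num.Theory.
Local Open Scope ring_scope.

(** * Resistance from a voltage function *)

Section Potential.

Variables (V : finType) (e : rel V) (R : realFieldType).

Lemma laplacian_mul_potential (f : V -> R) i :
  (laplacian e R *m \col_j f (enum_val j)) i 0 =
  \sum_(z | e (enum_val i) z) (f (enum_val i) - f z).
Proof.
set w := enum_val i.
have -> : \sum_(z | e w z) (f w - f z) =
    (deg e w)%:R * f w - \sum_z (e w z)%:R * f z.
  rewrite sumrB sumr_const -[f w *+ _]mulr_natl /deg cardsE; congr (_ - _).
  rewrite big_mkcond; apply: eq_bigr => z _.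
  by case: (e w z); rewrite (mul1r, mul0r).
rewrite (reindex (@enum_val V predT)) /=; last first.
  by apply: onW_bij; apply: enum_val_bij.
rewrite mxE; under [LHS]eq_bigr do rewrite !mxE mulrBl (eq_sym i).
rewrite sumrB (bigD1 i) //= eqxx big1 ?addr0 // => j /negPf ->.
by rewrite mul0r.
Qed.

Lemma trmx_laplacian : symmetric e -> (laplacian e R)^T = laplacian e R.
Proof.
move=> e_sym; apply/matrixP => i j; rewrite !mxE e_sym eq_sym.
by case: eqP => [->|].
Qed.

(** Summation by parts: after expanding [g w - g z], swapping the ends of each oriented edge turns
    the [g z] half into a second copy of the [g w] half. *)
Lemma energy_sym (f g : V -> R) : symmetric e ->
  \sum_w \sum_(z | e w z) (f w - f z) * (g w - g z) =
  2 * \sum_w g w * \sum_(z | e w z) (f w - f z).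
Proof.
move=> e_sym; rewrite mulr_natl mulr2n.
have {2}-> : \sum_w g w * \sum_(z | e w z) (f w - f z) =
    \sum_w \sum_(z | e w z) - (g z * (f w - f z)).
  under eq_bigr do rewrite mulr_sumr.
  rewrite (exchange_big_dep predT) //=; apply: eq_bigr => z _.
  by apply: eq_big => [w|w _]; [rewrite e_sym | ring].
rewrite -big_split; apply: eq_bigr => w _ /=.
rewrite mulr_sumr -big_split; apply: eq_bigr => z _ /=; ring.
Qed.

(** The hypothesis amounts to L F = d. Then d^T X d = F^T (L X L) F = F^T d for the pseudoinverse X
    of the Laplacian L. The factor 2 appears because each edge is summed in both orientations. *)
Lemma resistance_potential (f : V -> R) (u v : V) : symmetric e ->
  (forall g : V -> R,
    \sum_w \sum_(z | e w z) (f w - f z) * (g w - g z) = 2 * (g u - g v)) ->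
  resistance e R u v = f u - f v.
Proof.
move=> e_sym weak; rewrite /resistance.
set d := (_ - _ : 'cV_ _).
have pick (F : V -> R) a : \sum_w (w == a)%:R * F w = F a.
  rewrite (bigD1 a) //= eqxx mul1r big1 ?addr0 // => w /negPf ->.
  by rewrite mul0r.
pose F : 'cV[R]_#|V| := \col_j f (enum_val j).
have LF : laplacian e R *m F = d.
  apply/colP => i; rewrite laplacian_mul_potential !mxE eqxx !andbT.
  (* Testing against the indicator of one vertex isolates one coordinate of L F. *)
  have := weak (fun z => (z == enum_val i)%:R).
  rewrite energy_sym // pick => /(mulfI (_ : 2 != 0)) -> //.
    by rewrite -!(can2_eq (@enum_valK _) (@enum_rankK _)) !(eq_sym (enum_val i)).
  by rewrite pnatr_eq0.
have [] := pinvP (laplacian e R); move: (pinv _) => X LXL _ _ _.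
rewrite -LF trmx_mul trmx_laplacian // mulmxA -!(mulmxA F^T).
by rewrite LXL LF mulmxBr -!colE !mxE !enum_rankK.
Qed.

End Potential.

(** * Degree sums and sums over lifted edges *)

Lemma handshake (V : finType) (e : rel V) : symmetric e -> irreflexive e ->
  (\sum_u deg e u = #|edges e| * 2)%N.
Proof.
move=> e_sym e_irr; rewrite mulnC.
have sz A : A \in edges e -> #|A| = 2%N.
  rewrite inE => /existsP[u /existsP[v /andP[euv /eqP ->]]].
  by rewrite cards2; case: eqP euv => // ->; rewrite e_irr.
rewrite -sum1_card big_distrr /=.
(* Incident pairs of a vertex and an edge are counted in two ways; the edges at [u] correspond to
   its neighbours [v] through {u, v}. *)
transitivity (\sum_(A in edges e) \sum_(u in A) 1)%N; last first.
  by apply: eq_bigr => A /sz; rewrite sum1_card muln1.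
rewrite (exchange_big_dep predT) //=; apply: eq_bigr => u _.
rewrite sum1dep_card /deg.
have inj_u : {in [set v | e u v] &, injective (fun v => [set u; v])}.
  move=> v w; rewrite !inE => euv euw /setP/(_ v); rewrite !inE eqxx orbT.
  by case: eqP euv => [->|_ _ /esym/eqP //]; rewrite e_irr.
rewrite -(card_in_imset inj_u); apply: eq_card => A; rewrite !inE.
apply/imsetP/andP => [[v]|[/existsP[a /existsP[b /andP[eab /eqP->]]]]].
  rewrite inE => euv ->; rewrite !inE eqxx; split=> //.
  by apply/existsP; exists u; apply/existsP; exists v; rewrite euv eqxx.
rewrite !inE => /orP[]/eqP->; first by exists b; rewrite ?inE.
by exists a; rewrite ?inE 1?e_sym // setUC.
Qed.

Section EdgeBijection.

Variables (U V : finType) (e : rel U) (e' : rel V) (pi : U -> V).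
Hypothesis e'P : forall S T, reflect
  (exists a b, [/\ pi a = S, pi b = T & e a b]) (e' S T).
Hypothesis pi_inj : forall a b a' b', e a b -> e a' b' ->
  pi a = pi a' -> pi b = pi b' -> (a, b) = (a', b').

(** By the two hypotheses, [pi] induces a bijection from the oriented edges of [e] onto those of
    [e']. *)
Lemma sum_edges (M : nmodType) (F : V -> V -> M) :
  \sum_S \sum_(T | e' S T) F S T = \sum_a \sum_(b | e a b) F (pi a) (pi b).
Proof.
rewrite !pair_big_dep /=.
rewrite -[RHS](@big_imset _ 0 +%R _ _ (fun ab => (pi ab.1, pi ab.2))
  [pred ab | e ab.1 ab.2] (fun ST => F ST.1 ST.2)) /=; last first.
  by move=> [a b] [a' b'] /= ab ab' [] Ea Eb; apply: pi_inj.
apply: eq_bigl => -[S T] /=; apply/e'P/imsetP.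
  by case=> a [b [<- <- ab]]; exists (a, b).
by case=> -[a b] ab [-> ->]; exists a, b.
Qed.

End EdgeBijection.

(** * The quotient map of a vertex identification *)

Section Identification.

Variables (U : finType) (e g : rel U).

Let eqv_equiv : {in [set: U] & &, equivalence_rel (identify_eqv g)}.
Proof.
have rsym : connect_sym [rel a b | g a b || g b a].
  by apply: sym_connect_sym => c d /=; rewrite orbC.
move=> a b c _ _ _; split; first exact: connect0.
by move=> ab; apply: (same_connect rsym).
Qed.

Definition identify_class (a : U) : identify_vertex g.
Proof.
exists [set b in [set: U] | identify_eqv g a b].
by rewrite /equivalence_partition; apply/imsetP; exists a; rewrite ?inE.
Defined.

Lemma mem_identify_class a b : (b \in val (identify_class a)) = identify_eqv g a b.
Proof. by rewrite !inE. Qed.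

Lemma identify_class_refl a : a \in val (identify_class a).
Proof. by rewrite mem_identify_class; apply: connect0. Qed.

Lemma identify_classE a b :
  (identify_class a == identify_class b) = identify_eqv g a b.
Proof.
apply/eqP/idP => [Eab|ab].
  by rewrite -mem_identify_class Eab identify_class_refl.
apply: val_inj; apply/setP => c; rewrite !inE.
by have [] := @eqv_equiv a b c; rewrite ?inE // => _ ->.
Qed.

Lemma identify_class_mem (S : identify_vertex g) a :
  a \in val S -> identify_class a = S.
Proof.
case/imsetP: (valP S) => c _ defS; rewrite defS !inE => ca.
apply/esym/val_inj; rewrite defS.
by rewrite -identify_classE in ca; move/eqP: ca => <-.
Qed.

Lemma identify_class_surj (S : identify_vertex g) :
  exists a, identify_class a = S.
Proof.
case/imsetP: (valP S) => c _ defS; exists c.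
by apply: identify_class_mem; rewrite defS !inE; apply: connect0.
Qed.

Lemma identify_adjP (S T : identify_vertex g) : reflect
  (exists a b, [/\ identify_class a = S, identify_class b = T & e a b])
  (identify_adj e g S T).
Proof.
apply: (iffP existsP) => [[a /andP[aS /existsP[b /andP[bT ab]]]]|].
  by exists a, b; split=> //; apply: identify_class_mem.
case=> a [b [<- <- ab]]; exists a; rewrite identify_class_refl.
by apply/existsP; exists b; rewrite identify_class_refl.
Qed.

End Identification.

(** * Positions and distances on the cycle *)

Section Cycle.

Variables (m : nat) (x : 'I_m).

(** Number of [ordS] steps from [x] to [k]; adding [m - x] rather than subtracting [x] avoids
    truncated subtraction. *)
Definition cycle_pos (k : 'I_m) : nat := ((k + (m - x)) %% m)%N.

Lemma cycle_gt0 : (0 < m)%N. Proof. by case: m x => // -[]. Qed.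

Lemma cycle_pos_lt k : (cycle_pos k < m)%N.
Proof. by rewrite ltn_mod cycle_gt0. Qed.

Lemma val_iter_ordS s : val (iter s (@ordS m) x) = ((x + s) %% m)%N.
Proof.
elim: s => [|s IHs] /=; first by rewrite addn0 modn_small.
by rewrite IHs addnS -addn1 modnDml addn1.
Qed.

Lemma cycle_pos_iter s : cycle_pos (iter s (@ordS m) x) = (s %% m)%N.
Proof.
rewrite /cycle_pos val_iter_ordS modnDml -addnA addnCA.
by rewrite subnKC ?modnDr // ltnW.
Qed.

Lemma iter_cycle_pos k : iter (cycle_pos k) (@ordS m) x = k.
Proof.
apply: val_inj; rewrite val_iter_ordS modnDmr addnCA subnKC 1?ltnW //.
by rewrite modnDr modn_small.
Qed.

Lemma cycle_pos_ordS k : cycle_pos (ordS k) = ((cycle_pos k).+1 %% m)%N.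
Proof. by rewrite -{1}[k]iter_cycle_pos -iterS cycle_pos_iter. Qed.

Lemma iter_ordS_full : iter m (@ordS m) x = x.
Proof. by apply: val_inj; rewrite val_iter_ordS modnDr modn_small. Qed.

Lemma cycle_pos_id : cycle_pos x = 0%N.
Proof. by rewrite /cycle_pos subnKC ?modnn // ltnW. Qed.

Lemma cycle_pos_inj : injective cycle_pos.
Proof. by move=> k l E; rewrite -[k]iter_cycle_pos E iter_cycle_pos. Qed.

Lemma sum_cycle (M : nmodType) (F : 'I_m -> M) :
  \sum_k F k = \sum_(0 <= s < m) F (iter s (@ordS m) x).
Proof.
rewrite big_mkord; apply: reindex.
exists (fun k => Ordinal (cycle_pos_lt k)) => k _.
  by apply: val_inj; rewrite /= cycle_pos_iter modn_small.
exact: iter_cycle_pos.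
Qed.

(** The two arcs from [x] to [y] are walks of lengths [a] and [m - a], and no walk is shorter than
    both. *)
Lemma gdist_cycle : gdist (cycle_adj m) x =1 fun y =>
  minn (cycle_pos y) (m - cycle_pos y).
Proof.
move=> y; set a := cycle_pos y; have ltam : (a < m)%N := cycle_pos_lt y.
have walk (f : 'I_m -> 'I_m) s : (forall k, cycle_adj m k (f k)) ->
    has_walk (cycle_adj m) x (iter s f x) s.
  move=> adj_f; apply/existsP.
  have sz : size (traject f (f x) s) == s by rewrite size_traject.
  exists (Tuple sz); apply/andP; split; last by apply/eqP/last_traject.
  by apply: sub_path (fpath_traject f x s) => k l /eqP <-; apply: adj_f.
have walk_up : has_walk (cycle_adj m) x y a.
  by rewrite -[y]iter_cycle_pos; apply: walk => k; rewrite /cycle_adj /= eqxx.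
have walk_down : has_walk (cycle_adj m) x y (m - a).
  have -> : y = iter (m - a) (@ord_pred m) x.
    have -> : x = iter (m - a) (@ordS m) y.
      by rewrite -[y]iter_cycle_pos -iterD subnK ?iter_ordS_full // ltnW.
    by elim: (m - a)%N => //= s IHs; rewrite -iterS iterSr ordSK.
  by apply: walk => k; rewrite /cycle_adj /= ord_predK eqxx orbT.
(* Induction on the last step of the walk: each step changes the position by one modulo [m], so [k]
   steps reach only positions at most [k] or at least [m - k]. *)
have far k : has_walk (cycle_adj m) x y k -> (a <= k)%N || (m <= a + k)%N.
  case/existsP=> s /andP[px /eqP Ey]; rewrite /a -{}Ey.
  case: s px => s /= /eqP <-{k}.
  elim/last_ind: s => [|s' z IHs]; first by rewrite cycle_pos_id.
  rewrite rcons_path last_rcons size_rcons => /andP[/IHs{IHs}].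
  set w := last x s' => IHs /orP[]/eqP Ew; move: IHs.
    rewrite Ew cycle_pos_ordS; have := cycle_pos_lt w.
    rewrite leq_eqVlt => /orP[/eqP->|lt]; first by rewrite modnn.
    by rewrite modn_small //; lia.
  rewrite Ew cycle_pos_ordS; have := cycle_pos_lt z.
  rewrite leq_eqVlt => /orP[/eqP E|lt]; first by rewrite E modnn; lia.
  by rewrite modn_small //; lia.
have conn : connect (cycle_adj m) x y.
  case/existsP: walk_up => s /andP[px /eqP Ey].
  by apply/connectP; exists s.
have [/far walk_d min_d] := gdistP conn.
by have := min_d _ walk_up; have := min_d _ walk_down; lia.
Qed.

End Cycle.

Arguments cycle_pos {m} x k.

(** * The Green function of the cycle and its power sums *)

Section Green.

Variable R : realFieldType.

(* Voltage at s when a unit current enters the m-cycle at t and leaves at 0. *)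
Definition green (m s t : nat) : R :=
  (minn s t)%:R - s%:R * t%:R / m%:R.

Lemma green0s m t : green m 0 t = 0.
Proof. by rewrite /green min0n !mul0r subr0. Qed.

Lemma green_full m t : (t <= m)%N -> green m m t = 0.
Proof.
case: m => [|m] tm; first by rewrite green0s.
by rewrite /green (minn_idPr tm) mulrAC divff ?mul1r ?subrr // pnatr_eq0.
Qed.

Lemma green_diag_gt0 m t : (0 < t < m)%N -> 0 < green m t t.
Proof.
case/andP=> t_gt0 tm; rewrite /green minnn subr_gt0.
rewrite ltr_pdivrMr ?ltr0n ?(ltn_trans t_gt0) //.
by rewrite ltr_pM2l ?ltr0n // ltr_nat.
Qed.

Lemma sum_prefix (V : zmodType) n t (psi : nat -> V) : (t <= n)%N ->
  \sum_(0 <= s < n) (psi s.+1 - psi s) *+ (s < t) = psi t - psi 0.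
Proof.
move=> tn; rewrite (big_cat_nat _ tn) //= [X in _ + X]big_nat_cond.
rewrite [X in _ + X]big1 => [|s /andP[/andP[ts _] _]]; last first.
  by rewrite ltnNge ts.
rewrite addr0 -(telescope_sumr psi (leq0n t)).
by apply: eq_big_nat => s /andP[_ ->].
Qed.

(** The increment of [green] at [s] is 1 - t/m before [t] and - t/m afterwards. The indicator part
    telescopes up to [t]; the constant part telescopes around the closed cycle to 0. *)
Lemma green_energy m t (phi : nat -> R) : (t <= m)%N -> phi m = phi 0 ->
  \sum_(0 <= s < m) (green m s.+1 t - green m s t) * (phi s.+1 - phi s)
  = phi t - phi 0.
Proof.
move=> tm phi_m.
transitivity (\sum_(0 <= s < m) ((phi s.+1 - phi s) *+ (s < t)
    - t%:R / m%:R * (phi s.+1 - phi s))).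
  apply: eq_bigr => s _; have -> : green m s.+1 t - green m s t =
      (s < t)%:R - t%:R / m%:R.
    have min_S : minn s.+1 t = (minn s t + (s < t))%N by lia.
    by rewrite /green min_S natrD -(natr1 s); ring.
  by rewrite mulrBl [(s < t)%:R * _]mulr_natl.
rewrite sumrB sum_prefix // -mulr_sumr telescope_sumr //.
by rewrite phi_m subrr mulr0 subr0.
Qed.

Lemma sum_nat_id n : \sum_(0 <= s < n) s%:R = n%:R * (n%:R - 1) / 2 :> R.
Proof.
elim: n => [|n IHn]; first by rewrite big_geq // !mul0r.
by rewrite big_nat_recr //= IHn -natr1; field.
Qed.

Lemma sum_nat_sqr n :
  \sum_(0 <= s < n) s%:R ^+ 2 = n%:R * (n%:R - 1) * (2 * n%:R - 1) / 6 :> R.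
Proof.
elim: n => [|n IHn]; first by rewrite big_geq // !mul0r.
by rewrite big_nat_recr //= IHn -natr1; field.
Qed.

Lemma sum_quadratic n (A B C : R) :
  \sum_(i < n) (A + B * i%:R + C * i%:R ^+ 2) =
  A * n%:R + B * (n%:R * (n%:R - 1) / 2)
  + C * (n%:R * (n%:R - 1) * (2 * n%:R - 1) / 6).
Proof.
rewrite -sum_nat_id -sum_nat_sqr !big_mkord !big_split /=.
by rewrite -!mulr_sumr sumr_const card_ord mulr_natr.
Qed.

Lemma sum_minn a n : (a <= n)%N ->
  \sum_(0 <= s < n) (minn s a)%:R = a%:R * n%:R - a%:R * (a%:R + 1) / 2 :> R.
Proof.
(* Induction from n = a, where every minimum is [s]; each further term equals [a]. *)
move=> /subnK <-; elim: (n - a)%N => [|q IHq].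
  rewrite add0n (eq_big_nat _ _ (F2 := fun s => s%:R)).
    by rewrite sum_nat_id; field.
  by move=> s /andP[_ sa]; rewrite (minn_idPl (ltnW sa)).
rewrite addSn big_nat_recr //= IHq (minn_idPr _) ?leq_addl // -natr1; ring.
Qed.

Lemma sum_minn_sqr a n : (a <= n)%N ->
  \sum_(0 <= s < n) (minn s a)%:R ^+ 2 =
  a%:R ^+ 2 * n%:R - a%:R * (a%:R + 1) * (4 * a%:R - 1) / 6 :> R.
Proof.
move=> /subnK <-; elim: (n - a)%N => [|q IHq].
  rewrite add0n (eq_big_nat _ _ (F2 := fun s => s%:R ^+ 2)).
    by rewrite sum_nat_sqr; field.
  by move=> s /andP[_ sa]; rewrite (minn_idPl (ltnW sa)).
rewrite addSn big_nat_recr //= IHq (minn_idPr _) ?leq_addl // -natr1; ring.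
Qed.

Lemma sum_mul_minn a n : (a <= n)%N ->
  \sum_(0 <= s < n) s%:R * (minn s a)%:R =
  a%:R * n%:R * (n%:R - 1) / 2 - a%:R * (a%:R ^+ 2 - 1) / 6 :> R.
Proof.
move=> /subnK <-; elim: (n - a)%N => [|q IHq].
  rewrite add0n (eq_big_nat _ _ (F2 := fun s => s%:R ^+ 2)).
    by rewrite sum_nat_sqr; field.
  by move=> s /andP[_ sa]; rewrite (minn_idPl (ltnW sa)).
by rewrite addSn big_nat_recr //= IHq (minn_idPr _) ?leq_addl // -natr1; field.
Qed.

Section Sums.

Variable m : nat.
Hypothesis m_gt0 : (0 < m)%N.

Let m_neq0 : m%:R != 0 :> R.
Proof. by rewrite pnatr_eq0 -lt0n. Qed.

Lemma sum_green t : (t <= m)%N ->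
  \sum_(0 <= s < m) green m s t = t%:R * (m%:R - t%:R) / 2.
Proof.
move=> tm; rewrite sumrB sum_minn // -!mulr_suml sum_nat_id.
by field.
Qed.

Lemma sum_green_diag :
  \sum_(0 <= s < m) green m s s = (m%:R ^+ 2 - 1) / 6.
Proof.
under eq_bigr do rewrite /green minnn -expr2.
by rewrite sumrB sum_nat_id -mulr_suml sum_nat_sqr; field.
Qed.

(** The form of the right-hand side matters: it depends on [a] only through [green m a a], which
    later becomes the resistance [rho] of one copy. *)
Lemma sum_green_sqr a : (a <= m)%N ->
  \sum_(0 <= s < m) green m s a ^+ 2 =
  green m a a ^+ 2 * m%:R / 3 + green m a a / 6.
Proof.
move=> am; under eq_bigr => s _.
  have -> : green m s a ^+ 2 = (minn s a)%:R ^+ 2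
      - 2 * a%:R / m%:R * (s%:R * (minn s a)%:R) + a%:R ^+ 2 / m%:R ^+ 2 * s%:R ^+ 2.
    by rewrite /green; field.
  over.
rewrite big_split sumrB -!mulr_sumr /= sum_minn_sqr // sum_mul_minn // sum_nat_sqr.
by rewrite /green minnn; field.
Qed.

End Sums.

Lemma sum_sum_minn n :
  \sum_(i < n) \sum_(j < n) (minn i j)%:R =
  n%:R * (n%:R - 1) * (2 * n%:R - 1) / 6 :> R.
Proof.
(* By [sum_minn] the inner sum is i n - i (i + 1) / 2, a quadratic in i. *)
transitivity (\sum_(i < n) (0 + (n%:R - 1 / 2) * i%:R + - 2^-1 * i%:R ^+ 2) : R).
  apply: eq_bigr => i _; under eq_bigr do rewrite minnC.
  by have := sum_minn i n (ltnW (ltn_ord i)); rewrite big_mkord => ->; field.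
by rewrite sum_quadratic; field.
Qed.

End Green.

(** * The Green function on the vertices of the cycle, grounded at [x] *)

Section CycleGreen.

Variables (R : realFieldType) (m : nat) (x : 'I_m).

(** Voltage at [k] when a unit current enters at [l] and leaves at [x]; on the diagonal it is the
    effective resistance between [l] and [x]. *)
Definition cgreen (k l : 'I_m) : R := green R m (cycle_pos x k) (cycle_pos x l).

Lemma cgreenC k l : cgreen k l = cgreen l k.
Proof. by rewrite /cgreen /green minnC (mulrC _%:R). Qed.

Lemma cgreen_pole l : cgreen x l = 0.
Proof. by rewrite /cgreen cycle_pos_id green0s. Qed.

Lemma cgreen_diag_gt0 k : k != x -> 0 < cgreen k k.
Proof.
move=> nkx; apply: green_diag_gt0; rewrite [X in _ && X]cycle_pos_lt lt0n andbT.
by rewrite -(cycle_pos_id m x) (inj_eq (@cycle_pos_inj m x)).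
Qed.

Lemma cgreen_energy (phi : 'I_m -> R) l :
  \sum_k (cgreen (ordS k) l - cgreen k l) * (phi (ordS k) - phi k)
  = phi l - phi x.
Proof.
have lt_l := cycle_pos_lt m x l.
have := green_energy R m _ (fun s => phi (iter s (@ordS m) x)) (ltnW lt_l).
rewrite iter_cycle_pos (sum_cycle m x) => <-.
  apply: eq_big_nat => s /andP[_ lt_s]; congr (_ * _).
  rewrite /cgreen -!iterS !cycle_pos_iter (modn_small lt_s); congr (_ - _).
  (* On the last step the position wraps to 0 instead of reaching [m]; [green] vanishes at both. *)
  move: lt_s; rewrite leq_eqVlt => /orP[/eqP->|lt]; last by rewrite modn_small.
  by rewrite modnn green0s green_full // ltnW.
by rewrite iter_ordS_full.
Qed.

Lemma sum_cycle_pos (F : nat -> R) :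
  \sum_(k : 'I_m) F (cycle_pos x k) = \sum_(0 <= s < m) F s.
Proof.
rewrite (sum_cycle m x); apply: eq_big_nat => s /andP[_ lt_s].
by rewrite cycle_pos_iter modn_small.
Qed.

Lemma sum_cgreen l : \sum_k cgreen k l = m%:R * cgreen l l / 2.
Proof.
rewrite (sum_cycle_pos (fun s => green R m s (cycle_pos x l))).
have m_neq0 : m%:R != 0 :> R by rewrite pnatr_eq0 -lt0n (cycle_gt0 m x).
rewrite sum_green ?(cycle_gt0 m x) ?(ltnW (cycle_pos_lt m x l)) //.
by rewrite /cgreen /green minnn; field.
Qed.

Lemma sum_cgreen_diag : \sum_k cgreen k k = (m%:R ^+ 2 - 1) / 6.
Proof.
rewrite (sum_cycle_pos (fun s => green R m s s)) sum_green_diag //.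
exact: cycle_gt0 x.
Qed.

Lemma sum_sum_cgreen :
  \sum_l \sum_k cgreen k l = m%:R * (m%:R ^+ 2 - 1) / 12.
Proof.
under eq_bigr do rewrite sum_cgreen.
have m_neq0 : m%:R != 0 :> R by rewrite pnatr_eq0 -lt0n (cycle_gt0 m x).
by rewrite -mulr_suml -mulr_sumr sum_cgreen_diag; field.
Qed.

Lemma sum_cgreen_sqr l :
  \sum_k cgreen k l ^+ 2 = cgreen l l ^+ 2 * m%:R / 3 + cgreen l l / 6.
Proof.
rewrite (sum_cycle_pos (fun s => green R m s (cycle_pos x l) ^+ 2)).
by rewrite sum_green_sqr ?(cycle_gt0 m x) ?(ltnW (cycle_pos_lt m x l)).
Qed.

End CycleGreen.

Arguments cgreen R {m} x k l.

Lemma sum_prod (I J : finType) (M : nmodType) (F : I * J -> M) :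
  \sum_a F a = \sum_i \sum_j F (i, j).
Proof. by rewrite pair_bigA; apply: eq_bigr => -[]. Qed.

(** With [G] a Green function the summand is the resistance between [a] and [b], so the total
    resistance needs only the trace and the full sum of [G]. *)
Lemma sum_green_form (I : finType) (R : pzRingType) (G : I -> I -> R) :
  \sum_a \sum_b (G a a + G b b - G a b - G b a) =
  2 * #|I|%:R * \sum_a G a a - 2 * \sum_a \sum_b G a b.
Proof.
under eq_bigr do rewrite !sumrB big_split /= sumr_const.
rewrite !sumrB big_split /= sumr_const sumrMnl [X in _ - X]exchange_big /=.
by rewrite -addrA -opprD -!mulr2n -!mulrnA -mulrA !mulr_natl -mulrnA mulnC.
Qed.

Lemma ordS2_neq n (i : 'I_n) : (2 < n)%N -> ordS (ordS i) != i.
Proof.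
move=> n_gt2; rewrite -val_eqE /=; have := ltn_ord i.
rewrite leq_eqVlt => /orP[/eqP Ei|lt].
  by rewrite Ei modnn modn_small; lia.
rewrite (modn_small lt); move: lt; rewrite leq_eqVlt => /orP[/eqP Ei|lt].
  by rewrite Ei modnn; lia.
by rewrite modn_small //; lia.
Qed.

(** * Edges and degrees of the sunflower, read on the copies *)

Section Sunflower.

Variables (R : realFieldType) (m n : nat) (x y : 'I_m).
Hypotheses (m_gt2 : (2 < m)%N) (n_gt2 : (2 < n)%N) (nxy : x != y).

Local Notation pi := (identify_class _ (sunflower_glue n x y)).
Local Notation adj := (sunflower_adj n x y).

Lemma sum_copies_adj (M : nmodType) (F : 'I_n * 'I_m -> 'I_n * 'I_m -> M) :
  \sum_a \sum_(b | copies_adj n m a b) F a b =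
  \sum_i \sum_k (F (i, k) (i, ordS k) + F (i, ordS k) (i, k)).
Proof.
rewrite sum_prod; apply: eq_bigr => i _; rewrite big_split /=.
rewrite [X in _ = _ + X](reindex_inj (can_inj (@ord_predK m))) /=.
rewrite -big_split; apply: eq_bigr => k _ /=; rewrite ord_predK.
(* For m > 2 the two neighbours of [k] are distinct, so each vertex contributes exactly two
   terms. *)
have neq : ord_pred k != ordS k.
  by rewrite -(inj_eq (can_inj (@ordSK m))) ord_predK eq_sym ordS2_neq.
rewrite (bigD1 (i, ordS k)) /=; last by rewrite /copies_adj /cycle_adj /= !eqxx.
congr (_ + _); rewrite (big_pred1 (i, ord_pred k)) // => -[j l] /=.
rewrite /copies_adj /cycle_adj /= !xpair_eqE (eq_sym j) (eq_sym k).
rewrite (can2_eq (@ordSK m) (@ord_predK m) l).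
case: (i == j) => //=; case: (l =P ord_pred k) => [->|_].
  by rewrite (negPf neq).
by rewrite orbF andbN.
Qed.

Lemma sunflower_class_eq i k i' k' : pi (i, k) = pi (i', k') ->
  [\/ i = i' /\ k = k', [/\ k = y, k' = x & i' = ordS i]
    | [/\ k = x, k' = y & i = ordS i']].
Proof.
move=> /eqP; rewrite identify_classE sunflower_eqvE // /sunflower_rep /=.
case: (k =P y) => [->|_]; case: (k' =P y) => [->|_];
  rewrite xpair_eqE => /andP[/eqP Ei /eqP Ek].
- apply: Or31; split=> //; apply: (can_inj (@ordSK n)) Ei.
- by apply: Or32.
- by apply: Or33.
- by apply: Or31.
Qed.

Lemma sunflower_class_glue i : pi (i, y) = pi (ordS i, x).
Proof.
apply/eqP; rewrite identify_classE sunflower_eqvE // /sunflower_rep /=.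
by rewrite eqxx (negPf nxy).
Qed.

(** Gluing merges no two edges. If the edges differ, some end is identified with a vertex of an
    adjacent copy. Both ends shifting the same way forces [k = l]; any other combination forces a
    copy to be its own first or second successor, impossible for n > 2. *)
Lemma sunflower_class_inj a b a' b' : copies_adj n m a b -> copies_adj n m a' b' ->
  pi a = pi a' -> pi b = pi b' -> (a, b) = (a', b').
Proof.
case: a b a' b' => [i k] [j l] [i' k'] [j' l'].
rewrite /copies_adj /cycle_adj /= => /andP[/eqP <- kl] /andP[/eqP <- kl'].
have neq1 (t : 'I_n) : t <> ordS t.
  by apply/eqP; rewrite eq_sym ordS_neq // ltnW.
have neq2 (t : 'I_n) : t <> ordS (ordS t).
  by apply/eqP; rewrite eq_sym ordS2_neq.
have nkl : k <> l.
  apply/eqP; case/orP: kl => /eqP ->; last exact/ordS_neq/ltnW.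
  by rewrite eq_sym; apply/ordS_neq/ltnW.
move=> /sunflower_class_eq[[Ei Ek]|[Ek Ek' Ei]|[Ek Ek' Ei]];
  move=> /sunflower_class_eq[[Ei2 El]|[El El' Ei2]|[El El' Ei2]].
- by rewrite Ei Ek El.
- by case: (neq1 i); rewrite -Ei2.
- by case: (neq1 i'); rewrite -Ei2.
- by case: (neq1 i); rewrite -Ei.
- by case: nkl; rewrite Ek.
- by case: (neq2 i); rewrite -Ei.
- by case: (neq1 i'); rewrite -Ei.
- by case: (neq2 i); rewrite -Ei2.
- by case: nkl; rewrite Ek.
Qed.

Lemma sum_sunflower_adj (M : nmodType) F :
  \sum_S \sum_(T | adj S T) F S T =
  \sum_a \sum_(b | copies_adj n m a b) F (pi a) (pi b) :> M.
Proof.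
apply: sum_edges => [S T|]; first exact: identify_adjP.
exact: sunflower_class_inj.
Qed.

(** Every vertex of the copies has degree 2 and edges lift uniquely, so a class has degree twice its
    size. *)
Lemma sum_sunflower_deg (F : _ -> R) :
  \sum_S (deg adj S)%:R * F S = 2 * \sum_a F (pi a).
Proof.
transitivity (\sum_S \sum_(T | adj S T) F S).
  by apply: eq_bigr => S _; rewrite sumr_const /deg cardsE mulr_natl.
rewrite sum_sunflower_adj sum_copies_adj sum_prod mulr_natl mulr2n -big_split /=.
apply: eq_bigr => i _; rewrite big_split; congr (_ + _) => /=.
by rewrite [RHS](reindex_inj (can_inj (@ordSK m))).
Qed.

Lemma card_sunflower_edges : #|edges adj|%:R = n%:R * m%:R :> R.
Proof.
have adj_sym := @sunflower_adj_sym n m x y.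
have adj_irr : irreflexive adj by apply: sunflower_adj_irr; first exact: ltnW.
apply: (mulIf (_ : 2 != 0)); first by rewrite pnatr_eq0.
rewrite -[LHS]natrM -(handshake _ adj adj_sym adj_irr) natr_sum.
transitivity (\sum_S (deg adj S)%:R * 1 : R).
  by apply: eq_bigr => S _; rewrite mulr1.
by rewrite (sum_sunflower_deg (fun=> 1)) sumr_const card_prod !card_ord natrM mulrC.
Qed.

Lemma kemeny_sunflower :
  kemeny adj R =
  (n%:R * m%:R)^-1 * \sum_a \sum_b resistance adj R (pi a) (pi b).
Proof.
rewrite /kemeny card_sunflower_edges.
under eq_bigr => S _.
  under eq_bigr do rewrite -mulrA.
  rewrite -mulr_sumr sum_sunflower_deg mulrCA; over.
(* Each of the two degree weights has produced a factor 2, cancelling the 4 in the definition of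
   [kemeny]. *)
rewrite -mulr_sumr sum_sunflower_deg; set s := \sum_a _.
by field; rewrite !pnatr_eq0 -!lt0n (ltn_trans _ m_gt2) // (ltn_trans _ n_gt2).
Qed.

Lemma sunflower_energy f g :
  \sum_w \sum_(z | adj w z) (f w - f z) * (g w - g z) =
  2 * \sum_i \sum_k (f (pi (i, ordS k)) - f (pi (i, k)))
    * (g (pi (i, ordS k)) - g (pi (i, k))) :> R.
Proof.
rewrite sum_sunflower_adj sum_copies_adj mulr_sumr; apply: eq_bigr => i _.
by rewrite mulr_sumr; apply: eq_bigr => k _; ring.
Qed.

(** * The Green function of the sunflower *)

Local Notation cg := (cgreen R x).
Local Notation rho := (cg y y).

(** Voltage along the ring cut open at (0, x) when a unit current traverses the whole chain of
    copies towards (0, x). It plays the role of [s] in [green], with total resistance n [rho] in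
    place of [m]. *)
Definition sunflower_pos (a : 'I_n * 'I_m) : R := rho * a.1%:R + cg a.2 y.

(* Voltage at a when a unit current enters at b and leaves at (0, x): the term
   without the product is the voltage once the ring of copies is cut open at
   (0, x). *)
Definition sunflower_green (a b : 'I_n * 'I_m) : R :=
  rho * (minn a.1 b.1)%:R
  + cg (if (b.1 < a.1)%N then y else a.2) (if (a.1 < b.1)%N then y else b.2)
  - sunflower_pos a * sunflower_pos b / (n%:R * rho).

Let rho_neq0 : rho != 0.
Proof. by rewrite lt0r_neq0 // cgreen_diag_gt0 // eq_sym. Qed.

Let n_neq0 : n%:R != 0 :> R.
Proof. by rewrite pnatr_eq0; case: n n_gt2. Qed.

(** Away from the cut the two values agree term by term. At the last copy, the cut-open term at (i,
    y) is [sunflower_pos b], and the product term is n [rho] times [sunflower_pos b] over n [rho];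
    they cancel to the value 0 at (0, x). *)
Lemma sunflower_green_glue i b :
  sunflower_green (i, y) b = sunflower_green (ordS i, x) b.
Proof.
case: b => j l; rewrite /sunflower_green /sunflower_pos /= cgreen_pole.
have := ltn_ord i; rewrite leq_eqVlt => /orP[/eqP Ei|lt].
  have -> : (i.+1 %% n = 0)%N by rewrite Ei modnn.
  rewrite min0n ltn0 /= !mulr0 !add0r !mul0r subr0.
  have le_ji : (j <= i)%N by rewrite -ltnS Ei.
  rewrite (minn_idPr le_ji) [(i < j)%N]ltnNge le_ji /= cgreen_pole.
  have -> : (if (j < i)%N then y else y) = y by case: ifP.
  have -> : i%:R = n%:R - 1 :> R.
    by rewrite -[in RHS](congr1 (fun k => k%:R) Ei) -natr1 addrK.
  by rewrite (cgreenC _ _ _ y l); field; apply/andP.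
rewrite (modn_small lt); congr (_ - _ * _ / _); last by rewrite -natr1; ring.
rewrite if_same; case: (ltngtP i j) => [ij|ji|ij].
- have -> : (j < i.+1)%N = false by lia.
  have -> : minn i.+1 j = i.+1 by lia.
  by rewrite cgreen_pole -natr1; ring.
- have [-> ->] : (j < i.+1)%N = true /\ (i.+1 < j)%N = false by lia.
  by have -> : minn i.+1 j = j by lia.
- have [-> ->] : (j < i.+1)%N = true /\ (i.+1 < j)%N = false by lia.
  by have -> : minn i.+1 j = i by lia.
Qed.

Lemma sunflower_green_class a a' b :
  pi a = pi a' -> sunflower_green a b = sunflower_green a' b.
Proof.
case: a a' => [i k] [i' k'].
by case/sunflower_class_eq => [[-> ->]|[-> -> ->]|[-> -> ->]];
  rewrite ?sunflower_green_glue.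
Qed.

(** The computation of [green_energy] one level up: each copy is evaluated by [cgreen_energy], then
    the voltage drops [d i] across the copies telescope around the ring. *)
Lemma sunflower_green_energy (phi : 'I_n * 'I_m -> R) b (o : 'I_n) :
  val o = 0%N -> (forall i, phi (i, y) = phi (ordS i, x)) ->
  \sum_i \sum_k (sunflower_green (i, ordS k) b - sunflower_green (i, k) b)
    * (phi (i, ordS k) - phi (i, k)) = phi b - phi (o, x).
Proof.
case: b => j l o0 phi_glue; set c := sunflower_pos (j, l) / (n%:R * rho).
pose d i := phi (ordS i, x) - phi (i, x).
transitivity (\sum_i (d i *+ (i < j)%N + (phi (j, l) - phi (j, x)) *+ (i == j)
    - c * d i)).
  apply: eq_bigr => i _; pose t := if (i < j)%N then y else l.
  (* The cut-open current in copy [i] exits at [x] and enters at [t]: at [y] before copy [j], at [l]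
     in copy [j]. It is zero in later copies, where the cut-open term does not depend on [k]. *)
  transitivity (\sum_k
    (((cg (ordS k) t - cg k t) * (phi (i, ordS k) - phi (i, k))) *+ (i <= j)%N
    - c * ((cg (ordS k) y - cg k y) * (phi (i, ordS k) - phi (i, k))))).
    apply: eq_bigr => k _; rewrite /sunflower_green /sunflower_pos /= -/t /c.
    by rewrite /sunflower_pos /=; case: leqP => _; rewrite ?mulr0n ?mulr1n; ring.
  rewrite sumrB -mulr_sumr sumrMnl !(cgreen_energy _ _ _ (fun k => phi (i, k))).
  rewrite phi_glue -/(d i) /t; congr (_ - _).
  rewrite -val_eqE /=; case: (ltngtP i j) => [||/val_inj->].
  - by rewrite phi_glue addr0.
  - by rewrite !mulr0n addr0.
  - by rewrite add0r.
have sum_d (w : 'I_n) : \sum_i d i *+ (i < w)%N = phi (w, x) - phi (o, x).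
  have w_pos : cycle_pos o w = w.
    by rewrite /cycle_pos [nat_of_ord o]o0 subn0 modnDr modn_small.
  rewrite (sum_cycle n o) -{2}(iter_cycle_pos n o w) w_pos.
  rewrite -(sum_prefix _ _ _ (fun s => phi (iter s (@ordS n) o, x))
    (ltnW (ltn_ord w))).
  apply: eq_big_nat => s /andP[_ lt_s]; congr (_ *+ nat_of_bool (_ < _)%N).
  by rewrite /= [LHS]val_iter_ordS o0 add0n modn_small.
(* The drops around the closed ring cancel, which removes the [c] term. *)
have sum_d0 : \sum_i d i = 0.
  by rewrite sumrB [X in _ - X](reindex_inj (can_inj (@ordSK n))) subrr.
rewrite sumrB big_split /= -mulr_sumr sum_d0 sum_d mulr0 subr0.
rewrite (bigD1 j) //= eqxx mulr1n big1 => [|i /negPf ->]; last by [].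
by rewrite addr0; ring.
Qed.

(** The voltage for a current from [a] to [b] is the difference of the Green functions with sources
    [a] and [b]; the currents leaving at (0, x) cancel. *)
Lemma resistance_sunflower a b :
  resistance adj R (pi a) (pi b) =
  sunflower_green a a + sunflower_green b b
  - sunflower_green a b - sunflower_green b a.
Proof.
(* A choice of representatives turns the function on the copies into one on classes; the value is
   independent of the choice. *)
have [s sK] : exists s, forall S, pi (s S) = S.
  exact: (fin_all_exists (identify_class_surj _ (sunflower_glue n x y))).
pose f S := sunflower_green (s S) a - sunflower_green (s S) b.
have fE c : f (pi c) = sunflower_green c a - sunflower_green c b.
  by rewrite /f !(sunflower_green_class (s (pi c)) c).
have n_gt0 : (0 < n)%N by case: n n_gt2.
rewrite (resistance_potential _ _ _ f) ?fE => [|S T|g]; first ring.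
  exact: sunflower_adj_sym.
rewrite sunflower_energy; congr (_ * _).
have energy := sunflower_green_energy (g \o pi) _ (Ordinal n_gt0) erefl
  (fun i => congr1 g (sunflower_class_glue i)).
transitivity (g (pi a) - g (pi (Ordinal n_gt0, x))
    - (g (pi b) - g (pi (Ordinal n_gt0, x)))).
  rewrite -!energy -sumrB; apply: eq_bigr => i _; rewrite -sumrB.
  by apply: eq_bigr => k _; rewrite !fE /=; ring.
by ring.
Qed.

(** * Trace and full sum of the Green function *)

Lemma sum_sunflower_green_diag :
  \sum_a sunflower_green a a =
  m%:R * rho * (n%:R ^+ 2 - 3 * n%:R) / 6 + (n%:R * (m%:R ^+ 2 - 1) - 1) / 6.
Proof.
(* Summing over the vertices of copy [i] leaves a quadratic in i. *)
transitivity (\sum_(i < n) ((m%:R ^+ 2 - 1) / 6 - (m%:R * rho / 3 + 6^-1) / n%:R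
    + m%:R * rho * (1 - n%:R^-1) * i%:R + - (m%:R * rho / n%:R) * i%:R ^+ 2)).
  rewrite sum_prod; apply: eq_bigr => i _.
  transitivity (\sum_k (rho * i%:R * (1 - i%:R / n%:R) + cg k k
      - (2 * i%:R / n%:R * cg k y + (n%:R * rho)^-1 * cg k y ^+ 2))).
    apply: eq_bigr => k _; rewrite /sunflower_green /sunflower_pos /= ltnn minnn.
    by field; apply/andP.
  rewrite sumrB big_split [X in _ - X]big_split /= -!mulr_sumr.
  rewrite sum_cgreen sum_cgreen_sqr sum_cgreen_diag.
  by rewrite sumr_const card_ord -[_ *+ m]mulr_natl; field; apply/andP.
by rewrite sum_quadratic; field.
Qed.

Lemma sum_sunflower_pos : \sum_a sunflower_pos a = m%:R * rho * n%:R ^+ 2 / 2.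
Proof.
transitivity (\sum_(i < n) (m%:R * rho / 2 + m%:R * rho * i%:R + 0 * i%:R ^+ 2)).
  rewrite sum_prod; apply: eq_bigr => i _; rewrite /sunflower_pos big_split /=.
  by rewrite sumr_const card_ord sum_cgreen -mulr_natl; ring.
by rewrite sum_quadratic; field.
Qed.

Lemma sum_sum_sunflower_green :
  \sum_a \sum_b sunflower_green a b =
  n%:R * m%:R * (m%:R * rho * (n%:R ^+ 2 - 4) + (m%:R ^+ 2 - 1)) / 12.
Proof.
rewrite /sunflower_green.
under eq_bigr do rewrite sumrB -mulr_suml -mulr_sumr sum_sunflower_pos.
rewrite sumrB -!mulr_suml sum_sunflower_pos sum_prod.
under eq_bigr do under eq_bigr do rewrite sum_prod.
under eq_bigr do rewrite exchange_big.
(* The [cg] terms of two distinct copies sum to m^2 [rho] / 2; [Q] is the correction when the copies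
   coincide. *)
pose Q : R := m%:R * (m%:R ^+ 2 - 1) / 12 - m%:R ^+ 2 * rho / 2.
transitivity (\sum_(i < n) \sum_(j < n) (m%:R ^+ 2 * rho * (minn i j)%:R
    + m%:R ^+ 2 * rho / 2 + Q *+ (i == j))
  - m%:R * rho * n%:R ^+ 2 / 2 * (m%:R * rho * n%:R ^+ 2 / 2) / (n%:R * rho)).
  congr (_ - _); apply: eq_bigr => i _; apply: eq_bigr => j _ /=.
  under [LHS]eq_bigr do rewrite big_split /= sumr_const card_ord.
  rewrite big_split /= sumr_const card_ord -mulrnA -[_ *+ (m * m)]mulr_natr natrM.
  rewrite -addrA; congr (_ + _); first by ring.
  rewrite -val_eqE /=; case: (ltngtP i j) => _ /=.
  - under eq_bigr do rewrite sumr_const card_ord.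
    by rewrite sumrMnl sum_cgreen -[_ *+ m]mulr_natl; ring.
  - rewrite exchange_big /=; under eq_bigr do rewrite sumr_const card_ord cgreenC.
    by rewrite sumrMnl sum_cgreen -[_ *+ m]mulr_natl; ring.
  - by rewrite exchange_big sum_sum_cgreen /Q; ring.
have sum_Q (i : 'I_n) : \sum_j Q *+ (i == j) = Q.
  rewrite (bigD1 i) //= eqxx mulr1n big1 ?addr0 // => j.
  by rewrite eq_sym => /negPf ->.
under eq_bigr do
  rewrite big_split /= sum_Q big_split /= -mulr_sumr sumr_const card_ord.
rewrite big_split /= big_split /= -mulr_sumr sum_sum_minn !sumr_const card_ord.
rewrite -[_ *+ n *+ n]mulrnA -[_ *+ (n * n)]mulr_natl natrM -[Q *+ n]mulr_natl /Q.
by field; apply/andP.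
Qed.

End Sunflower.

(** * Kemeny's constant in closed form *)

Theorem theorem5p5 (R : realFieldType) (m n : nat) (hm : (3 <= m)%N)
    (hn : (3 <= n)%N) (x y : 'I_m) (hxy : x <> y)
    (p : nat) (hp : p = gdist (cycle_adj m) x y) :
  kemeny (sunflower_adj n x y) R =
    ((n%:R ^+ 2 - 6 * n%:R + 4) * (p%:R * m%:R - p%:R ^+ 2)
     + m%:R ^+ 2 * (2 * n%:R - 1) - 2 * n%:R - 1) / 6.
Proof.
have nxy : x != y by apply/eqP.
have m_neq0 : m%:R != 0 :> R by rewrite pnatr_eq0; case: (m) hm.
have n_neq0 : n%:R != 0 :> R by rewrite pnatr_eq0; case: (n) hn.
(* With [a] the position of [y], m times [cgreen y y] is a (m - a), which is unchanged by a -> m -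
   a, so it equals p (m - p) whichever arc is shorter. *)
have -> : p%:R * m%:R - p%:R ^+ 2 = m%:R * cgreen R x y y.
  have le_ym := ltnW (cycle_pos_lt m x y).
  rewrite hp gdist_cycle /cgreen /green minnn.
  by case: leqP => _; rewrite ?natrB //; field.
rewrite kemeny_sunflower //.
have -> : \sum_a \sum_b resistance (sunflower_adj n x y) R
      (identify_class _ (sunflower_glue n x y) a)
      (identify_class _ (sunflower_glue n x y) b) =
    2 * (n%:R * m%:R) * \sum_a sunflower_green R m n x y a a
    - 2 * \sum_a \sum_b sunflower_green R m n x y a b.
  under eq_bigr do under eq_bigr do rewrite resistance_sunflower //.
  by rewrite sum_green_form card_prod !card_ord natrM.
rewrite sum_sunflower_green_diag // sum_sum_sunflower_green //.
by field; apply/andP.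
Qed.
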